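(* In the setting of the context, let $$c_d:=-\int_0^\infty\Big(e^{-2dt}I_0(2t)^d-e^{-t}\Big)\frac{dt}{t},\qquad \mathcal{H}_{d,n}:=-\int_0^\infty\Big(\theta^{G_n}(t)-\Big(\prod_{i=1}^{d}a_i(n)\Big)e^{-2dt}I_0(2t)^d\Big)\frac{dt}{t}.$$ Then $$\log\det\Delta=\Big(\prod_{i=1}^{d}a_i(n)\Big)c_d+\mathcal{H}_{d,n}.$$
   Context: Fix $d\ge1$. For each $i$ let $(a_i(n))_n$ be positive integers with $a_i(n)/n\to\alpha_i>0$, and $w_{i,j}(n)$ ($0\le j\le a_i(n)-1$) complex numbers of modulus one. $G_n$ is the Cayley graph of $\prod_{i=1}^d\mathbb{Z}/a_i(n)\mathbb{Z}$ with generators $\pm e_i$; the oriented edge from $x$ to $x+e_i$ carries weight $w_{i,x_i}(n)$ ($x_i\in\{0,\ldots,a_i(n)-1\}$ the $i$-th coordinate) and the reverse edge the inverse weight. The bundle Laplacian is $\Delta f(v)=\sum_{u\sim v}(f(v)-\phi_{u,v}f(u))$ for $f:V\to\mathbb{C}$, where $\phi_{u,v}$ is the weight of the oriented edge from $u$ to $v$. Let $\lambda_i(n)\in[0,1)$ with $\prod_jw_{i,j}(n)=e^{2\pi i\lambda_i(n)}$; assume $\lambda_i(n)\to\lambda_i\in[0,1]$, that some index $i$ has $\lambda_i\notin\{0,1\}$, and that for this index $\lambda_i(n)\neq0$ for all $n$ (so $0$ is not an eigenvalue of $\Delta$). Define $\theta^{G_n}(t)=\prod_{i=1}^d a_i(n)e^{-2t}\sum_{k\in\mathbb{Z}}I_{ka_i(n)}(2t)\prod_{j=0}^{a_i(n)-1}w_{i,j}(n)^{-k}$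 (which equals $\operatorname{tr}e^{-t\Delta}$). $I_\nu$ is the modified Bessel function of the first kind of order $\nu$. *)

(* Defs.v *)
From mathcomp Require Import all_boot all_order all_algebra.
From mathcomp Require Import all_classical all_reals all_analysis.
From mathcomp Require Export complex.
Set Implicit Arguments.
Unset Strict Implicit.
Unset Printing Implicit Defensive.
Import Order.TTheory GRing.Theory Num.Theory.
Import numFieldNormedType.Exports.
Local Open Scope classical_set_scope.
Local Open Scope ring_scope.
Local Open Scope complex_scope.

Section ComplexAnalysis.
Variable R : realType.

(* e^{i x} *)
Definition expi (x : R) : R[i] := cos x +i* sin x.

(* Principal argument, in ]-pi, pi] for z != 0, and principal logarithm. *)
Definition carg (z : R[i]) : R :=
  if 0 <= complex.Im z then acos (complex.Re z / Normc.normc z)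
  else - acos (complex.Re z / Normc.normc z).

Definition clog (z : R[i]) : R[i] := ln (Normc.normc z) +i* carg z.

Definition csum (f : nat -> R[i]) : R[i] :=
  limn (series (fun k => complex.Re (f k)))
    +i* limn (series (fun k => complex.Im (f k))).

(* Bilateral series; [Posz k] is k and [Negz k] is -(k + 1). *)
Definition csumZ (f : int -> R[i]) : R[i] :=
  csum (fun k => f (Posz k)) + csum (fun k => f (Negz k)).

Definition cintegrable (D : set R) (f : R -> R[i]) : Prop :=
  (@lebesgue_measure R).-integrable D (EFin \o (fun t => complex.Re (f t))) /\
  (@lebesgue_measure R).-integrable D (EFin \o (fun t => complex.Im (f t))).

Definition cintegral (D : set R) (f : R -> R[i]) : R[i] :=
  (\int[lebesgue_measure]_(t in D) complex.Re (f t))%R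
    +i* (\int[lebesgue_measure]_(t in D) complex.Im (f t))%R.

(* Modified Bessel function of the first kind of integer order nu:
   \sum_m (x / 2) ^ (2 m + nu) / (m! Gamma (m + nu + 1)), where
   1 / Gamma (m + nu + 1) is 1 / (m + nu)! if m + nu >= 0 and 0 otherwise. *)
Definition besselI (nu : int) (x : R) : R :=
  limn (series (fun m : nat =>
    if 0 <= m%:Z + nu then
      (x / 2) ^+ (m + `|m%:Z + nu|) / (m`! * (`|m%:Z + nu|)`!)%:R
    else 0)).

End ComplexAnalysis.

Section Torus.
Variables (R : realType) (d : nat) (a : 'I_d -> nat).

Definition vertex : finType := {dffun forall i : 'I_d, 'I_(a i)}.

(* The 2d generators: (i, true) is +e_i and (i, false) is -e_i.  They are kept
   distinct even when they agree in the group, so that a i = 2 yields double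
   edges and a i = 1 yields loops. *)
Definition generator : finType := ('I_d * bool)%type.

Definition opposite (s : generator) : generator := (s.1, ~~ s.2).

Definition move (x : vertex) (s : generator) : vertex :=
  [ffun j => if j == s.1 then (if s.2 then ordS (x j) else ord_pred (x j))
             else x j].

Variable w : forall i : 'I_d, 'I_(a i) -> R[i].
Arguments w : clear implicits.

(* Weight of the oriented edge leaving u along the generator s; the edge from
   u to u - e_i is the reverse of the one from u - e_i to u. *)
Definition edge_weight (u : vertex) (s : generator) : R[i] :=
  if s.2 then w s.1 (u s.1) else (w s.1 (move u s s.1))^-1.

(* Each edge at v is described by the generator s leading from v to the
   neighbour u = move v s; oriented from u to v it leaves u along the opposite
   generator. *)
Definition laplacian (f : vertex -> R[i]) (v : vertex) : R[i] :=
  \sum_(s : generator)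
    (f v - edge_weight (move v s) (opposite s) * f (move v s)).

(* Matrix of the Laplacian in the basis of indicator functions of vertices. *)
Definition laplacian_mx : 'M[R[i]]_#|vertex| :=
  \matrix_(p, q)
    laplacian (fun x => (x == enum_val q)%:R) (enum_val p).

Definition theta (t : R) : R[i] :=
  \prod_(i < d)
    ((a i)%:R * (expR (- (2 * t)))%:C *
     csumZ (fun k : int =>
       (besselI (k * (a i)%:Z) (2 * t))%:C * \prod_(j < a i) w i j ^ (- k))).

Definition volume : nat := (\prod_(i < d) a i)%N.

Definition H_integrand (t : R) : R[i] :=
  (theta t
   - volume%:R * (expR (- (2 * d%:R * t)) * besselI 0 (2 * t) ^+ d)%:C)
  / t%:C.

Definition H_const : R[i] := - cintegral `]0, +oo[ H_integrand.

End Torus.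

Section Constant.
Variables (R : realType) (d : nat).

Definition c_integrand (t : R) : R :=
  (expR (- (2 * d%:R * t)) * besselI 0 (2 * t) ^+ d - expR (- t)) / t.

Definition c_const : R :=
  - (\int[lebesgue_measure]_(t in `]0, +oo[) c_integrand t)%R.

End Constant.

Arguments c_const : clear implicits.

(* Main.v *)
(** The Laplacian is diagonalised by products of twisted characters of the cyclic
factors: with [z = e^{-2 pi i (m + lambda) / a}], the function
[x |-> z^x w_0 ... w_{x-1}] is well defined on Z/a because [z^a] cancels the
holonomy [e^{2 pi i lambda}].  Hence [det = \prod_k mu_k] with
[mu_k = \sum_i (2 - 2 cos (2 pi (k_i + lambda_i) / a_i)) > 0].  On the other side,
averaging the Jacobi-Anger expansion [e^{x cos phi} = \sum_n I_n(x) e^{i n phi}]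
over the angles [2 pi (m + lambda) / a] keeps only the multiples of [a], so that
[theta t = \sum_k e^{-t mu_k}].  Writing [V] for the volume and
[g t = (e^{-2t} I_0(2t))^d], the identity
[theta - V g = \sum_k (e^{-t mu_k} - e^{-t}) - V (g - e^{-t})] reduces the theorem
to Frullani's integral, once [(g - e^{-t}) / t] is known to be integrable; at
infinity this follows from [e^{-x} I_0(x) <= 1 / (2 sqrt x)]. *)
Require Import Defs.
From mathcomp Require Import all_boot all_order all_algebra.
From mathcomp Require Import all_classical all_reals all_analysis.
From mathcomp Require Import measurable_realfun.
From mathcomp Require Import ring lra zify.
Import Order.TTheory GRing.Theory Num.Theory.
Import numFieldNormedType.Exports.
Local Open Scope classical_set_scope.
Local Open Scope ring_scope.
Local Open Scope complex_scope.

(** * Circle characters and finite sums *)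

Lemma expiD (R : realType) (x y : R) : expi (x + y) = expi x * expi y.
Proof. by rewrite /expi cosD sinD; simpc; rewrite [cos x * sin y + _]addrC. Qed.

Lemma expi0 (R : realType) : expi (0 : R) = 1.
Proof. by rewrite /expi cos0 sin0. Qed.

Lemma expiX (R : realType) (x : R) n : expi x ^+ n = expi (n%:R * x).
Proof.
elim: n => [|n IH]; first by rewrite expr0 mul0r expi0.
by rewrite exprS IH -expiD -[in RHS]natr1 mulrDl mul1r addrC.
Qed.

Lemma expi_neq0 (R : realType) (x : R) : expi x != 0.
Proof.
apply/eqP => x0; have := expiD R x (- x).
by rewrite x0 mul0r subrr expi0 => /eqP; rewrite oner_eq0.
Qed.

Lemma expiN (R : realType) (x : R) : expi (- x) = (expi x)^-1.
Proof.
apply: (mulfI (expi_neq0 R x)).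
by rewrite -expiD subrr expi0 mulfV ?expi_neq0.
Qed.

Lemma expi2piz (R : realType) n : expi (2 * pi * n%:R : R) = 1.
Proof.
have e1 : expi (2 * pi : R) = 1.
  by rewrite /expi mulrC mulr_natr cos2pi sin2pi.
by rewrite mulrC -expiX e1 expr1n.
Qed.

Lemma expi_eq1_frac (R : realType) (q : R) :
  0 < `|q| < 1 -> expi (2 * pi * q) != 1.
Proof.
wlog q0 : q / 0 <= q => [hw|].
  have [/hw//|/ltW q0] := leP 0 q.
  move=> hq; have := hw (- q); rewrite normrN oppr_ge0 => /(_ q0 hq).
  by rewrite mulrN expiN invr_eq1.
rewrite ger0_norm // => /andP[q_gt0 q1].
apply/eqP => /(congr1 (@complex.Re R)) /=.
(* The real part would give 1 - 2 sin(pi q)^2 = 1, whereas 0 < pi q < pi makes the sine positive. *)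
rewrite (_ : 2 * pi * q = (pi * q) *+ 2); last by ring.
rewrite cos_mulr2n cos2sin2.
have : 0 < sin (pi * q).
  apply: sin_gt0_pi; rewrite mulr_gt0 ?pi_gt0 //=.
  by rewrite gtr_pMr ?pi_gt0.
move=> s0; rewrite -mulr_natl => h.
have : sin (pi * q) ^+ 2 = 0 by lra.
by move/eqP; rewrite sqrf_eq0 gt_eqF.
Qed.

Lemma sum_expr_root1 (F : fieldType) (u : F) n :
  u ^+ n = 1 -> u != 1 -> \sum_(x < n) u ^+ x = 0.
Proof.
move=> un u1; apply: (mulfI (_ : u - 1 != 0)); first by rewrite subr_eq0.
by rewrite -subrX1 un subrr mulr0.
Qed.

(** The antidiagonal p + q = m is indexed by i = q. This turns a product of two power series,
    truncated in total degree, into a partial sum of a single series. *)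
Lemma sum_triangle (V : nmodType) (A : nat -> nat -> V) N :
  \sum_(p < N) \sum_(q < N - p) A p q =
  \sum_(m < N) \sum_(i < m.+1) A (m - i)%N i.
Proof.
elim: N => [|N IH]; first by rewrite !big_ord0.
rewrite [RHS]big_ord_recr /= -IH.
have hs (p : 'I_N.+1) : \sum_(q < N.+1 - p) A p q =
    \sum_(q < N - p) A p q + A p (N - p)%N.
  by rewrite subSn ?big_ord_recr // -ltnS.
under eq_bigr do rewrite hs.
rewrite big_split /= big_ord_recr /= subnn big_ord0 addr0; congr +%R.
rewrite (reindex_inj rev_ord_inj) /=; apply: eq_bigr => i _.
by rewrite subSS subKn // -ltnS.
Qed.

(* Number of integers with absolute value [n]. *)
Definition fold_mult (n : nat) : nat := if n == 0 then 1 else 2.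

(** Entries are grouped by n = |p - q|; symmetry makes each diagonal n > 0 occur twice. The
    induction adds the last row and the last column of the square. *)
Lemma sum_square_diag (V : nmodType) (A : nat -> nat -> V) N :
  (forall p q, A p q = A q p) ->
  \sum_(p < N) \sum_(q < N) A p q =
  \sum_(n < N) (\sum_(q < N - n) A (q + n)%N q) *+ fold_mult n.
Proof.
move=> Asym; elim: N => [|N IH]; first by rewrite !big_ord0.
under eq_bigr => p _ do rewrite big_ord_recr /=.
rewrite big_split /= big_ord_recr /= IH.
have hs (n : 'I_N.+1) : (\sum_(q < N.+1 - n) A (q + n)%N q) *+ fold_mult n =
    (\sum_(q < N - n) A (q + n)%N q) *+ fold_mult n
    + A N (N - n)%N *+ fold_mult n.
  have nN : (n <= N)%N by rewrite -ltnS.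
  by rewrite subSn // big_ord_recr /= subnK // mulrnDl.
under [RHS]eq_bigr do rewrite hs.
rewrite [RHS]big_split /= [in RHS]big_ord_recr /= subnn big_ord0 mul0rn addr0.
rewrite -addrA; congr +%R.
(* The corner [A N N] is the new entry of the main diagonal n = 0; the other new entries are matched
   by reversing the index. *)
rewrite big_ord_recr [RHS]big_ord_recl /= subn0 mulr1n addrA addrC.
congr +%R; rewrite [RHS](reindex_inj rev_ord_inj) /=.
rewrite -big_split /=; apply: eq_bigr => i _.
have iN := ltn_ord i.
rewrite /bump /= (_ : N - (1 + (N - i.+1)) = i)%N; last by lia.
by rewrite [A i N]Asym mulr2n.
Qed.

(** Real part of the binomial expansion of (e^{i phi} + e^{-i phi})^M. *)
Lemma cos_expr_sum (R : realType) (phi : R) M :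
  (2 * cos phi) ^+ M =
  \sum_(i < M.+1) cos (((M - i)%:R - i%:R) * phi) *+ 'C(M, i).
Proof.
have h : (2 * cos phi)%:C = expi phi + expi (- phi).
  by apply/eqP; rewrite eq_complex /= cosN sinN subrr mulr_natl mulr2n !eqxx.
transitivity (complex.Re ((2 * cos phi)%:C ^+ M)).
  by rewrite -rmorphXn.
rewrite h exprDn raddf_sum /=; apply: eq_bigr => i _.
rewrite raddfMn; congr (_ *+ _).
by rewrite !expiX -expiD mulrN -mulNr -mulrDl.
Qed.

Lemma cvg_sumr (R : realType) (I : Type) (r : seq I) (f : I -> nat -> R) l :
  (forall i, f i N @[N --> \oo] --> l i) ->
  \sum_(i <- r) f i N @[N --> \oo] --> \sum_(i <- r) l i.
Proof.
move=> fl; elim: r => [|i r IH].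
  by rewrite big_nil; under eq_fun do rewrite big_nil; exact: cvg_cst.
by rewrite big_cons; under eq_fun do rewrite big_cons; apply: cvgD.
Qed.

Lemma complex_natr (R : realType) n : (n%:R : R[i]) = (n%:R : R)%:C.
Proof. exact: (esym (rmorph_nat (real_complex R) n)). Qed.

(** * Bessel functions and the Jacobi-Anger expansion *)

Section Bessel.
Variable R : realType.
Implicit Types (x y phi : R).

(** Here y stands for x / 2. The exponent is associated so that [besselI_nat] holds by
    computation. *)
Definition bessel_term y (n q : nat) : R :=
  y ^+ (q + (q + n)) / (q`! * (q + n)`!)%:R.

Lemma bessel_term_ge0 y n q : 0 <= y -> 0 <= bessel_term y n q.
Proof. by move=> y0; rewrite divr_ge0 ?exprn_ge0. Qed.

Lemma besselI_nat n x :
  besselI (Posz n) x = limn (series (bessel_term (x / 2) n)).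
Proof. by []. Qed.

(** A finite, exact form of Jacobi-Anger: the product of the series of e^{y e^{i phi}} and e^{y
    e^{-i phi}} is cut at total degree p + q < N and grouped by n = |p - q|. With p = q + n the
    cutoff reads q + q + n < N. *)
Lemma exp_partial_bessel y phi N :
  series (exp_coeff (2 * y * cos phi)) N =
  \sum_(n < N) (cos (n%:R * phi) *
    \sum_(q < N - n | (q + q + n < N)%N) bessel_term y n q) *+ fold_mult n.
Proof.
(* The cutoff is built into [A], so that the same sum can be read over the square and over the
   triangle. *)
pose A p q : R := if (p + q < N)%N
  then y ^+ (p + q) / (p`! * q`!)%:R * cos ((p%:R - q%:R) * phi) else 0.
transitivity (\sum_(p < N) \sum_(q < N) A p q).
  have -> : \sum_(p < N) \sum_(q < N) A p q =
     \sum_(p < N) \sum_(q < N - p) A p q.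
    apply: eq_bigr => p _.
    rewrite -!(big_mkord xpredT (A p)) /=.
    rewrite (big_cat_nat _ (n := (N - p)%N)) ?leq_subr //=.
    rewrite [X in _ + X]big_nat_cond [X in _ + X]big1 ?addr0 // => q.
    move=> /andP[/andP[h1 h2] _]; rewrite /A ifF //; apply/negbTE; lia.
  rewrite sum_triangle /series /= big_mkord; apply: eq_bigr => m _.
  rewrite /exp_coeff /=.
  rewrite (_ : 2 * y * cos phi = y * (2 * cos phi)); last by ring.
  rewrite exprMn cos_expr_sum mulr_sumr mulr_suml; apply: eq_bigr => i _.
  have im : (i <= m)%N by rewrite -ltnS.
  rewrite /A subnK // ltn_ord -(bin_fact im) -mulr_natr !natrM.
  have f0 k : (k`!%:R : R) != 0 by rewrite pnatr_eq0 -lt0n fact_gt0.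
  have c0 : ('C(m, i)%:R : R) != 0 by rewrite pnatr_eq0 -lt0n bin_gt0.
  by field; rewrite c0 !f0.
rewrite sum_square_diag; last first.
  move=> p q; rewrite /A addnC mulnC; case: ifP => // _.
  by congr (_ * _); rewrite -[RHS]cosN -mulNr opprB.
apply: eq_bigr => n _; congr (_ *+ _).
rewrite mulr_sumr [RHS]big_mkcond /=; apply: eq_bigr => q _.
rewrite /A addnAC; case: ifP => // _.
rewrite natrD addrAC subrr add0r mulrC /bessel_term [((q + n)`! * _)%N]mulnC.
by rewrite addnA.
Qed.

Lemma exp_partial_le_expR x N : 0 <= x -> series (exp_coeff x) N <= expR x.
Proof.
move=> x0; apply: nondecreasing_cvgn_le; last exact: is_cvg_series_exp_coeff.
apply/nondecreasing_seqP => n; rewrite /series /= big_nat_recr //= lerDl.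
exact: exp_coeff_ge0.
Qed.

(** At angle 0 all terms of [exp_partial_bessel] are nonnegative, so any finite rectangle of them is
    bounded by the full exponential. *)
Lemma bessel_partial_le y K Q : 0 <= y ->
  \sum_(n < K) (\sum_(q < Q) bessel_term y n q) *+ fold_mult n <= expR (2 * y).
Proof.
move=> y0.
(* The length Q + Q + K is large enough for the rectangle n < K, q < Q to lie in the region q + q +
   n < Q + Q + K. *)
apply: le_trans (exp_partial_le_expR (2 * y) (Q + Q + K) _); last by rewrite mulr_ge0.
have -> : 2 * y = 2 * y * cos 0 by rewrite cos0 mulr1.
rewrite exp_partial_bessel.
rewrite (big_ord_widen (Q + Q + K)%N
  (fun n => (\sum_(q < Q) bessel_term y n q) *+ fold_mult n)) ?leq_addl //.
rewrite big_mkcond /=; apply: ler_sum => n _.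
rewrite mulr0 cos0 mul1r.
case: ifP => [nK|_]; last first.
  by rewrite mulrn_wge0 // sumr_ge0 // => q _; exact: bessel_term_ge0.
rewrite lerMn2r; apply/orP; right.
rewrite (big_ord_widen (Q + Q + K - n)%N (bessel_term y n)); last by lia.
rewrite big_mkcond [leRHS]big_mkcond /=; apply: ler_sum => q _.
case: ifP => qQ; first by rewrite ifT //; lia.
by case: ifP => // _; exact: bessel_term_ge0.
Qed.

(** The partial sums increase, and each is dominated by the last row of the rectangle bound with K =
    n + 1. *)
Lemma is_cvg_bessel y n : 0 <= y -> cvgn (series (bessel_term y n)).
Proof.
move=> y0; apply: nondecreasing_is_cvgn.
  by apply/nondecreasing_seqP => k; rewrite /series /= big_nat_recr //= lerDl bessel_term_ge0.
exists (expR (2 * y)) => _ [Q _ <-].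
apply: le_trans (bessel_partial_le y n.+1 Q y0).
rewrite big_ord_recr /= /series /= big_mkord.
have s0 m : 0 <= \sum_(q < Q) bessel_term y m q.
  by rewrite sumr_ge0 // => q _; exact: bessel_term_ge0.
apply: (@le_trans _ _ ((\sum_(q < Q) bessel_term y n q) *+ fold_mult n)).
  by rewrite -[leLHS]mulr1n ler_wpMn2l // /fold_mult; case: ifP.
by rewrite lerDr sumr_ge0 // => m _; rewrite mulrn_wge0.
Qed.

Lemma besselI_nat_ge x n Q : 0 <= x ->
  \sum_(q < Q) bessel_term (x / 2) n q <= besselI (Posz n) x.
Proof.
move=> x0; rewrite besselI_nat -(big_mkord xpredT).
apply: (nondecreasing_cvgn_le _ (is_cvg_bessel _ _ _)); last by rewrite divr_ge0.
apply/nondecreasing_seqP => k.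
by rewrite /series /= big_nat_recr //= lerDl bessel_term_ge0 ?divr_ge0.
Qed.

Lemma besselI_nat_ge0 x n : 0 <= x -> 0 <= besselI (Posz n) x.
Proof. by move=> x0; have := besselI_nat_ge x n 0 x0; rewrite big_ord0. Qed.

Lemma sum_besselI_le x K : 0 <= x ->
  \sum_(n < K) besselI (Posz n) x *+ fold_mult n <= expR x.
Proof.
move=> x0; have y0 : 0 <= x / 2 by rewrite divr_ge0.
have h : \sum_(n < K) series (bessel_term (x / 2) n) Q *+ fold_mult n
    @[Q --> \oo] --> \sum_(n < K) besselI (Posz n) x *+ fold_mult n.
  apply: cvg_sumr => n; rewrite besselI_nat.
  by apply: cvgMn; exact: is_cvg_bessel.
rewrite -(cvg_lim _ h) //.
apply: limr_le; first by apply/cvg_ex; eexists; exact: h.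
apply: nearW => Q /=.
have := bessel_partial_le _ K Q y0.
rewrite [2 * _]mulrC divfK //; apply: le_trans.
by under eq_bigr => n _ do rewrite /series /= big_mkord.
Qed.

(** The real form, with the orders n and -n merged by [fold_mult]. Comparison with the partial sums
    of the exponential series avoids interchanging two infinite sums. *)
Lemma jacobi_anger x phi : 0 <= x ->
  series (fun n => (besselI (Posz n) x * cos (n%:R * phi)) *+ fold_mult n) N
    @[N --> \oo] --> expR (x * cos phi).
Proof.
move=> x0; have y0 : 0 <= x / 2 by rewrite divr_ge0.
pose D (c : R) (N : nat) : R := series (exp_coeff (x * c)) N.
have D_cvg c : D c @ \oo --> expR (x * c) by exact: is_cvg_series_exp_coeff.
(* Termwise, the defect at angle [phi] is at most the defect at angle 0, where
   both partial sums are bounded by their common limit [expR x]. *)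
have key N : `|series (fun n => (besselI (Posz n) x * cos (n%:R * phi))
    *+ fold_mult n) N - D (cos phi) N| <= expR x - D 1 N.
  have xE : x = 2 * (x / 2) by rewrite mulrC divfK.
  have DE c : D (cos c) N = \sum_(n < N) (cos (n%:R * c) *
    \sum_(q < N - n | (q + q + n < N)%N) bessel_term (x / 2) n q) *+ fold_mult n.
    by rewrite /D {1}xE exp_partial_bessel.
  rewrite (_ : D 1 N = D (cos 0) N); last by rewrite cos0.
  rewrite !DE {1}/series /= big_mkord -sumrB.
  apply: (@le_trans _ _ (\sum_(n < N) (besselI (Posz n) x -
    \sum_(q < N - n | (q + q + n < N)%N) bessel_term (x / 2) n q) *+ fold_mult n)).
    apply: le_trans (ler_norm_sum _ _ _) _; apply: ler_sum => n _.
    rewrite -mulrnBl normrMn lerMn2r; apply/orP; right.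
    have d0 : 0 <= besselI (Posz n) x -
        \sum_(q < N - n | (q + q + n < N)%N) bessel_term (x / 2) n q.
      rewrite subr_ge0; apply: le_trans (besselI_nat_ge x n (N - n) x0).
      rewrite big_mkcond /=; apply: ler_sum => q _.
      by case: ifP => // _; exact: bessel_term_ge0.
    rewrite [_ * cos _]mulrC -mulrBr normrM (ger0_norm d0) ler_piMl //.
    by rewrite ler_norml cos_geN1 cos_le1.
  under [leLHS]eq_bigr do rewrite mulrnBl.
  rewrite sumrB lerB ?sum_besselI_le //.
  by apply: ler_sum => n _; rewrite mulr0 cos0 mul1r.
have D1 : expR x - D 1 N @[N --> \oo] --> 0.
  rewrite -[X in _ --> X](subrr (expR x)); apply: cvgB; first exact: cvg_cst.
  by rewrite -[X in expR X]mulr1; exact: D_cvg.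
pose SD N : R := series (fun n => (besselI (Posz n) x * cos (n%:R * phi))
    *+ fold_mult n) N - D (cos phi) N.
have SD0 : SD N @[N --> \oo] --> 0.
  have D1N : - (expR x - D 1 N) @[N --> \oo] --> 0.
    by rewrite -[X in _ --> X]oppr0; exact: cvgN.
  have SD_near : \forall N \near \oo, - (expR x - D 1 N) <= SD N <= expR x - D 1 N.
    by exists 0%N => // N _ /=; rewrite -ler_norml key.
  exact: (squeeze_cvgr SD_near D1N D1).
rewrite (_ : series _ = SD \+ D (cos phi)); last first.
  by apply/funext => N; rewrite /SD /= subrK.
rewrite -[X in _ --> X]add0r; apply: cvgD SD0 _; exact: D_cvg.
Qed.

End Bessel.

Arguments bessel_term {R} y n q.

(** * Negative orders, and averaging over equally spaced angles *)

Section Bessel.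
Variable R : realType.
Implicit Types (x y phi : R).

(** For order -n the first n terms are 0, by the convention 1 / Gamma = 0 at the poles; shifting the
    index by n recovers the series of order n. *)
Lemma besselIN n x : 0 <= x -> besselI (- Posz n) x = besselI (Posz n) x.
Proof.
move=> x0; rewrite [RHS]besselI_nat; apply: cvg_lim => //.
have : series (bessel_term (x / 2) n) k @[k --> \oo] -->
    limn (series (bessel_term (x / 2) n)).
  by apply: is_cvg_bessel; rewrite divr_ge0.
move=> h; rewrite -(cvg_shiftn n) /=.
rewrite (_ : (fun k => _) = series (bessel_term (x / 2) n)) //.
apply/funext => k.
rewrite /series /= (big_cat_nat _ (n := n)) ?leq_addl //=.
rewrite [X in X + _]big_nat_cond [X in X + _]big1 ?add0r; last first.
  by move=> m /andP[/andP[_ mn] _]; rewrite ifF //; lia.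
rewrite -{1}[n]add0n big_addn addnK; apply: eq_bigr => q _.
rewrite ifT; last by lia.
rewrite (_ : `|_|%N = q); last by lia.
by rewrite /bessel_term addnAC addnA mulnC.
Qed.

(** Up to a phase this is a geometric sum of the root of unity u = e^{2 pi i n / a}, which vanishes
    unless u = 1. *)
Lemma sum_cos_arith (a n : nat) (lam : R) : (0 < a)%N ->
  \sum_(m < a) cos (n%:R * (2 * pi * (m%:R + lam) / a%:R)) =
  if (a %| n)%N then a%:R * cos (2 * pi * lam * (n %/ a)%:R) else 0.
Proof.
move=> a0; have aR : (a%:R : R) != 0 by rewrite pnatr_eq0 -lt0n.
pose u := expi (2 * pi * (n%:R / a%:R) : R).
have termE (m : 'I_a) : expi (n%:R * (2 * pi * (m%:R + lam) / a%:R)) =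
    expi (2 * pi * lam * (n%:R / a%:R)) * u ^+ m.
  by rewrite expiX -expiD; congr expi; ring.
have -> : \sum_(m < a) cos (n%:R * (2 * pi * (m%:R + lam) / a%:R)) =
   complex.Re (expi (2 * pi * lam * (n%:R / a%:R)) * \sum_(m < a) u ^+ m).
  rewrite mulr_sumr raddf_sum /=; apply: eq_bigr => m _.
  by rewrite -termE.
have ua : u ^+ a = 1.
  rewrite expiX -(expi2piz R n); congr expi; field; exact: aR.
case: ifP => [/dvdnP[k nE]|an].
  have u1 m : u ^+ m = 1.
    rewrite /u nE expiX -(expi2piz R (m * k)); congr expi; rewrite !natrM.
    by field.
  under eq_bigr do rewrite u1.
  rewrite nE mulnK // natrM mulfK // sumr_const card_ord.
  by rewrite complex_natr /= mulr0 subr0 mulrC.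
rewrite sum_expr_root1 ?mulr0 //.
(* Replacing n by its nonzero residue modulo a puts the fraction strictly between 0 and 1, as
   [expi_eq1_frac] requires. *)
have -> : u = expi (2 * pi * ((n %% a)%:R / a%:R) : R).
  rewrite -[RHS]mul1r -(expi2piz R (n %/ a)) -expiD -mulrDr /u {1}(divn_eq n a).
  by congr expi; rewrite natrD natrM; field.
apply: expi_eq1_frac.
have r0 : (0 < n %% a)%N by rewrite lt0n; move: an; rewrite /dvdn => ->.
rewrite ger0_norm ?divr_ge0 // divr_gt0 ?ltr0n //=.
by rewrite ltr_pdivrMr ?ltr0n // mul1r ltr_nat ltn_pmod.
Qed.

Lemma sum_dvdn (V : nmodType) (f : nat -> V) a K : (0 < a)%N ->
  \sum_(0 <= n < a * K | (a %| n)%N) f n = \sum_(0 <= k < K) f (a * k)%N.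
Proof.
move=> a0; elim: K => [|K IH]; first by rewrite muln0 !big_geq.
rewrite big_nat_recr //= -IH mulnS addnC.
rewrite (big_cat_nat _ (n := (a * K)%N)) ?leq_addr //=; congr +%R.
rewrite big_ltn_cond; last by lia.
rewrite dvdn_mulr // big_nat_cond big1 ?addr0 // => n.
move=> /andP[/andP[n1 n2] /dvdnP[k nE]]; exfalso; subst n.
rewrite [(k * a)%N]mulnC ltn_pmul2l // in n1.
by rewrite -mulnSr [(k * a)%N]mulnC ltn_pmul2l // in n2; lia.
Qed.

(** Averaging Jacobi-Anger over the a angles leaves only the orders divisible by a. *)
Lemma jacobi_anger_arith (a : nat) x (lam : R) : (0 < a)%N -> 0 <= x ->
  series (fun k => (besselI (Posz (a * k)) x * cos (2 * pi * lam * k%:R))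
                   *+ fold_mult k) N
    @[N --> \oo] -->
  (\sum_(m < a) expR (x * cos (2 * pi * (m%:R + lam) / a%:R))) / a%:R.
Proof.
move=> a0 x0; have aR : (a%:R : R) != 0 by rewrite pnatr_eq0 -lt0n.
pose S phi : R^nat := series (fun n =>
  (besselI (Posz n) x * cos (n%:R * phi)) *+ fold_mult n).
pose phi m : R := 2 * pi * (m%:R + lam) / a%:R.
have h : \sum_(m < a) S (phi m) N @[N --> \oo] -->
    \sum_(m < a) expR (x * cos (phi m)).
  by apply: cvg_sumr => m; exact: jacobi_anger.
(* Partial sums are sampled at the lengths a N, where exactly N multiples of a have been met. *)
have ha : \sum_(m < a) S (phi m) (a * N)%N @[N --> \oo] -->
    \sum_(m < a) expR (x * cos (phi m)).
  apply: (cvg_comp _ _ _ h); apply/cvgnyPge => A.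
  exists A => // N /= AN; apply: leq_trans AN _; exact: leq_pmull.
rewrite (_ : series _ = fun N => (\sum_(m < a) S (phi m) (a * N)%N) / a%:R).
  exact: (cvgMr_tmp ha).
apply/funext => N.
apply: (mulIf aR); rewrite divfK //.
pose g n : R := (besselI (Posz n) x * (a%:R * cos (2 * pi * lam * (n %/ a)%:R)))
  *+ fold_mult n.
have inner n : \sum_(m < a) (besselI (Posz n) x * cos (n%:R * phi m))
    *+ fold_mult n = if (a %| n)%N then g n else 0.
  rewrite sumrMnl -mulr_sumr sum_cos_arith //.
  by case: ifP => // _; rewrite mulr0 mul0rn.
have -> : \sum_(m < a) S (phi m) (a * N)%N =
    \sum_(0 <= n < a * N | (a %| n)%N) g n.
  rewrite /S /series /= exchange_big [RHS]big_mkcond /=.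
  by apply: eq_bigr => n _; rewrite inner.
rewrite sum_dvdn // /series /= mulr_suml; apply: eq_bigr => k _.
rewrite /g mulKn //.
have -> : fold_mult (a * k) = fold_mult k.
  by rewrite /fold_mult muln_eq0 gtn_eqF.
by rewrite -[in LHS]mulr_natr -[in RHS]mulr_natr; ring.
Qed.

End Bessel.

(** * Bilateral Bessel series twisted by the holonomy *)

Section BesselZ.
Variable R : realType.
Implicit Types (x lam : R).

Lemma cvg_series_shift (u : R^nat) l :
  series (fun k => u k.+1) @ \oo --> l -> series u @ \oo --> u 0%N + l.
Proof.
move=> ul; rewrite -cvg_shiftS.
rewrite (_ : [sequence _]_n = fun n => u 0%N + series (fun k => u k.+1) n).
  by apply: cvgD => //; exact: cvg_cst.
by apply/funext => n; rewrite /series /= big_nat_recl.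
Qed.

Lemma csumE (f : nat -> R[i]) (l m : R) :
  series (fun k => complex.Re (f k)) @ \oo --> l ->
  series (fun k => complex.Im (f k)) @ \oo --> m ->
  csum f = l +i* m.
Proof. by move=> fl fm; rewrite /csum (cvg_lim _ fl) ?(cvg_lim _ fm). Qed.

(** One half of the bilateral series: the term k = 0 is removed and the doubling by [fold_mult]
    undone. *)
Lemma cvg_bessel_cos_shift (a : nat) x lam : (0 < a)%N -> 0 <= x ->
  series (fun k => besselI (Posz (a * k.+1)) x * cos (2 * pi * lam * k.+1%:R))
    @ \oo -->
  ((\sum_(m < a) expR (x * cos (2 * pi * (m%:R + lam) / a%:R))) / a%:R
   - besselI 0 x) / 2.
Proof.
move=> a0 x0; have := jacobi_anger_arith R _ _ lam a0 x0.
rewrite -cvg_shiftS => h.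
rewrite (_ : series _ = fun N => (series (fun k => (besselI (Posz (a * k)) x *
    cos (2 * pi * lam * k%:R)) *+ fold_mult k) N.+1 - besselI 0 x) / 2).
  by apply: cvgMr_tmp; apply: cvgB; [exact: h|exact: cvg_cst].
apply/funext => N; rewrite /series /= big_nat_recl //= muln0 mulr0 cos0 mulr1.
rewrite /fold_mult /= mulr1n addrAC subrr add0r sumrMnl.
by rewrite [X in _ = X / _]mulr2n; field.
Qed.

(** Absolute convergence by comparison with the cosine series at [lam] = 0. Only the existence of
    the limit matters, since it cancels between k and -k. *)
Lemma is_cvg_bessel_sin_shift (a : nat) x lam : (0 < a)%N -> 0 <= x ->
  cvgn (series (fun k =>
    besselI (Posz (a * k.+1)) x * sin (2 * pi * lam * k.+1%:R))).
Proof.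
move=> a0 x0; apply: normed_cvg.
have hc : cvgn (series (fun k => besselI (Posz (a * k.+1)) x *
    cos (2 * pi * 0 * k.+1%:R))).
  by apply/cvg_ex; eexists; exact: cvg_bessel_cos_shift.
apply: series_le_cvg hc => k /=.
- exact: normr_ge0.
- by rewrite mulr0 mul0r cos0 mulr1 besselI_nat_ge0.
- rewrite mulr0 mul0r cos0 mulr1 normrM ger0_norm ?besselI_nat_ge0 //.
  by rewrite ler_piMr ?besselI_nat_ge0 // ler_norml sin_geN1 sin_le1.
Qed.

Lemma csumZ_bessel (a : nat) x lam (w : 'I_a -> R[i]) : (0 < a)%N -> 0 <= x ->
  \prod_j w j = expi (2 * pi * lam) ->
  a%:R * csumZ (fun k : int =>
    (besselI (k * a%:Z) x)%:C * \prod_(j < a) w j ^ (- k)) =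
  (\sum_(m < a) expR (x * cos (2 * pi * (m%:R + lam) / a%:R)))%:C.
Proof.
move=> a0 x0 wE; have aR : (a%:R : R) != 0 by rewrite pnatr_eq0 -lt0n.
have prodX n : \prod_(j < a) w j ^ (- Posz n) = expi (- (2 * pi * lam * n%:R)).
  rewrite expiN [_ * n%:R]mulrC -expiX -wE -prodrXl -prodfV.
  by apply: eq_bigr => j _; rewrite -exprnN.
have prodXS n : \prod_(j < a) w j ^ (- Negz n) = expi (2 * pi * lam * n.+1%:R).
  rewrite [_ * n.+1%:R]mulrC -expiX -wE -prodrXl.
  by apply: eq_bigr => j _; rewrite NegzE opprK.
(* [u] and [v] are the real and imaginary parts of the term of index k >= 0. As [Negz k] means -(k +
   1), the negative half is a series shifted by one, so both halves involve the same limits [l] and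
   [V]. *)
pose u k := besselI (Posz (a * k)) x * cos (2 * pi * lam * k%:R).
pose v k := - (besselI (Posz (a * k)) x * sin (2 * pi * lam * k%:R)).
have /cvg_ex[/= V hV] := is_cvg_bessel_sin_shift _ _ lam a0 x0.
have hC := cvg_bessel_cos_shift _ _ lam a0 x0.
set l := (_ / 2) in hC.
have pos : csum (fun k : nat => (besselI (Posz k * a%:Z) x)%:C *
    \prod_(j < a) w j ^ (- Posz k)) = (u 0%N + l) +i* (v 0%N - V).
  apply: csumE.
    rewrite (_ : series _ = series u); first exact: cvg_series_shift.
    congr series; apply/funext => k; rewrite prodX -PoszM mulnC.
    by rewrite /= cosN mul0r subr0.
  rewrite (_ : series _ = series v).
    apply: cvg_series_shift; rewrite (_ : series _ = fun N => - series (fun k =>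
        besselI (Posz (a * k.+1)) x * sin (2 * pi * lam * k.+1%:R)) N).
      exact: cvgN.
    by apply/funext => N; rewrite /series /= -sumrN.
  congr series; apply/funext => k; rewrite prodX -PoszM mulnC.
  by rewrite /= sinN mul0r addr0 mulrN.
have neg : csum (fun k : nat => (besselI (Negz k * a%:Z) x)%:C *
    \prod_(j < a) w j ^ (- Negz k)) = l +i* V.
  apply: csumE.
    rewrite (_ : (fun k => _) = fun k => u k.+1) //.
    apply/funext => k; rewrite prodXS NegzE mulNr -PoszM mulnC besselIN //.
    by rewrite /= mul0r subr0.
  rewrite (_ : (fun k => _) = fun k =>
    besselI (Posz (a * k.+1)) x * sin (2 * pi * lam * k.+1%:R)) //.
  apply/funext => k; rewrite prodXS NegzE mulNr -PoszM mulnC besselIN //.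
  by rewrite /= mul0r addr0.
rewrite /csumZ pos neg complex_natr /u /v /l muln0 mulr0 cos0 sin0.
apply/eqP; rewrite eq_complex /=; apply/andP; split; apply/eqP; last by ring.
by field.
Qed.

End BesselZ.

(** * Integrability of the volume term *)

Section BesselBound.
Variable R : realType.
Implicit Types (x t : R).

(** The squared quantity is b = C(2m, m) / 4^m. Passing from m to m + 1 multiplies the left side by
    (2m + 1)(2m + 3) / (2m + 2)^2 <= 1. *)
Lemma central_binomial_le m :
  ((2 * m)`!%:R / (m`!%:R ^+ 2 * 4 ^+ m) : R) ^+ 2 * (2 * m%:R + 1) <= 1.
Proof.
elim: m => [|m IH].
  by rewrite muln0 fact0 expr0 expr1n !mulr1 divr1 expr1n mul1r mulr0 add0r.
have f0 : (m`!%:R : R) != 0 by rewrite pnatr_eq0 -lt0n fact_gt0.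
have m0 : 0 <= (m%:R : R) by [].
have F1 : (m.+1`!%:R : R) = (m%:R + 1) * m`!%:R by rewrite factS natrM -natr1.
have F2 : ((2 * m.+1)`!%:R : R) =
    (2 * m%:R + 2) * ((2 * m%:R + 1) * (2 * m)`!%:R).
  rewrite mulnS add2n !factS !natrM -addn2 -[(2 * m).+1]addn1.
  by rewrite [(_ + 2)%:R]natrD [(_ + 1)%:R]natrD natrM.
set b := (X in X ^+ 2 * _ <= 1) in IH.
have -> : ((2 * m.+1)`!%:R / (m.+1`!%:R ^+ 2 * 4 ^+ m.+1) : R) =
    b * ((2 * m%:R + 1) / (2 * m%:R + 2)).
  rewrite F1 F2 /b (exprS 4 m).
  by field; rewrite f0 expf_neq0 //=; apply/andP; split; lra.
have -> : (m.+1%:R : R) = m%:R + 1 by rewrite natr1.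
have -> : (b * ((2 * m%:R + 1) / (2 * m%:R + 2))) ^+ 2 * (2 * (m%:R + 1) + 1) =
    b ^+ 2 * (2 * m%:R + 1) *
    (((2 * m%:R + 1) * (2 * m%:R + 3)) / (2 * m%:R + 2) ^+ 2).
  by field; lra.
apply: mulr_ile1 => //.
- by rewrite mulr_ge0 ?sqr_ge0 // addr_ge0 // mulr_ge0.
- rewrite ler_pdivrMr ?mul1r; last by rewrite exprn_gt0 //; lra.
  by nra.
Qed.

(* With [b = (2m)! / (m!^2 4^m)] the left side is [b x^(2m) / (2m)!]; the bound is
   [2 s b <= 1 + s^2 b^2 <= 1 + x / (2m + 1)] for [s = sqrt x]. *)
Lemma bessel_term0_le x m : 0 < x -> bessel_term (x / 2) 0 m <=
  (2 * Num.sqrt x)^-1 * (exp_coeff x (2 * m)%N + exp_coeff x (2 * m).+1).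
Proof.
move=> x0; set s := Num.sqrt x.
have s0 : 0 < s by rewrite sqrtr_gt0.
have sx : s ^+ 2 = x by rewrite sqr_sqrtr // ltW.
have f0 : (m`!%:R : R) != 0 by rewrite pnatr_eq0 -lt0n fact_gt0.
have g0 : ((2 * m)`!%:R : R) != 0 by rewrite pnatr_eq0 -lt0n fact_gt0.
have m0 : 0 <= (m%:R : R) by [].
have := central_binomial_le m; set b := (X in X ^+ 2 * _ <= 1) => hb.
have b0 : 0 <= b by rewrite divr_ge0 // mulr_ge0 ?exprn_ge0.
have -> : bessel_term (x / 2) 0 m = x ^+ (2 * m) / (2 * m)`!%:R * b.
  rewrite /bessel_term /b addn0 addnn -mul2n expr_div_n natrM.
  have -> : (4 : R) ^+ m = 2 ^+ (2 * m) by rewrite exprM; congr (_ ^+ _); ring.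
  by field; rewrite f0 g0 expf_neq0.
have -> : exp_coeff x (2 * m)%N + exp_coeff x (2 * m).+1 =
    x ^+ (2 * m) / (2 * m)`!%:R * (1 + x / (2 * m%:R + 1)).
  rewrite /exp_coeff /= factS exprS natrM -natr1 natrM.
  by field; rewrite g0 /=; lra.
clearbody b; rewrite mulrCA; apply: ler_wpM2l; first by rewrite divr_ge0 ?exprn_ge0 // ltW.
rewrite mulrC ler_pdivlMr ?mulr_gt0 //.
have hx : x * b ^+ 2 <= x / (2 * m%:R + 1).
  rewrite ler_pdivlMr; last by lra.
  by rewrite -mulrA ler_piMr // ltW.
rewrite -sx in hx *.
have : 0 <= (1 - s * b) ^+ 2 by exact: sqr_ge0.
by nra.
Qed.

(** The m-th Bessel term is controlled by the exponential coefficients of degrees 2m and 2m + 1, so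
    Q Bessel terms are controlled by 2Q terms of the series of e^x. *)
Lemma besselI0_le_sqrt x : 0 < x -> expR (- x) * besselI 0 x <= (2 * Num.sqrt x)^-1.
Proof.
move=> x0; have s0 : 0 < Num.sqrt x by rewrite sqrtr_gt0.
rewrite expRN mulrC ler_pdivrMr ?expR_gt0 //.
rewrite besselI_nat; apply: limr_le.
  by apply: is_cvg_bessel; rewrite divr_ge0 // ltW.
exists 0%N => // Q _ /=.
apply: (@le_trans _ _ ((2 * Num.sqrt x)^-1 * series (exp_coeff x) (2 * Q)%N)).
  have -> : series (exp_coeff x) (2 * Q)%N =
      \sum_(0 <= m < Q) (exp_coeff x (2 * m)%N + exp_coeff x (2 * m).+1).
    elim: Q => [|Q IH]; first by rewrite /series /= muln0 !big_geq.
    by rewrite big_nat_recr //= -IH mulnS add2n /series /= !big_nat_recr //= addrA.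
  rewrite mulr_sumr /series /=; apply: ler_sum => m _; exact: bessel_term0_le.
apply: ler_wpM2l; first by rewrite invr_ge0 mulr_ge0 // ltW.
by apply: exp_partial_le_expR; exact: ltW.
Qed.

Lemma besselI0_ge1 x : 0 <= x -> 1 <= besselI 0 x.
Proof.
move=> x0; have := besselI_nat_ge R x 0 1 x0.
by rewrite big_ord1 /bessel_term /= expr0 fact0 muln1 divr1.
Qed.

Lemma besselI0_le_expR x : 0 <= x -> besselI 0 x <= expR x.
Proof.
by move=> x0; have := sum_besselI_le R x 1 x0; rewrite big_ord1 mulr1n.
Qed.

End BesselBound.

(** * An integrable majorant, and measurability *)

Section ConstantIntegrable.
Variable R : realType.
Implicit Types (x t : R).

Let mu := @lebesgue_measure R.

(** This is (1 + t)^{-3/2}: bounded at 0, with the decay t^{-3/2} that [c_integrand] has at infinity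
    in the slowest case d = 1. *)
Definition dominating (t : R) : R := ((1 + t) * Num.sqrt (1 + t))^-1.

Lemma dominating_ge0 t : 0 <= t -> 0 <= dominating t.
Proof.
by move=> t0; rewrite invr_ge0 mulr_ge0 ?sqrtr_ge0 // addr_ge0.
Qed.

Lemma integrable_dominating : mu.-integrable `]0, +oo[ (EFin \o dominating).
Proof.
(* The antiderivative -2 (1 + t)^{-1/2}, which tends to 0 at infinity. *)
pose F t : R := - 2 * (Num.sqrt (1 + t))^-1.
have s_gt0 t : 0 <= t -> 0 < Num.sqrt (1 + t).
  by move=> t0; rewrite sqrtr_gt0 ltr_pwDl.
have sq_cont t : {for t, continuous (fun t : R => Num.sqrt (1 + t))}.
  apply: continuous_comp; last exact: sqrt_continuous.
  by apply: cvgD; [exact: cvg_cst|exact: cvg_id].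
have F_cont t : 0 <= t -> {for t, continuous F}.
  move=> t0; apply: cvgMl_tmp; apply: cvgV; first by rewrite gt_eqF ?s_gt0.
  exact: sq_cont.
have d_cont t : 0 <= t -> {for t, continuous dominating}.
  move=> t0; apply: cvgV.
    by rewrite mulf_neq0 // gt_eqF ?s_gt0 // ltr_pwDl.
  by apply: cvgM; [apply: cvgD; [exact: cvg_cst|exact: cvg_id]|exact: sq_cont].
have F_der t : 0 < t -> is_derive t 1 F (dominating t).
  move=> t0; have s0 := s_gt0 t (ltW t0).
  have h1 : is_derive t 1 (fun t : R => 1 + t) 1.
    by have := is_deriveD (is_derive_cst (1 : R) t 1) (is_derive_id t 1); rewrite add0r.
  have h2 : is_derive (1 + t) 1 Num.sqrt (2 * Num.sqrt (1 + t))^-1.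
    by apply: is_derive1_sqrt; rewrite ltr_pwDl // ltW.
  have h3 : is_derive t 1 (fun t : R => Num.sqrt (1 + t)) (2 * Num.sqrt (1 + t))^-1.
    by have := is_derive1_comp h2 h1; rewrite mulr1.
  have h4 := @is_deriveV _ (fun t : R => Num.sqrt (1 + t)) _ _ _ (lt0r_neq0 s0) h3.
  have := is_deriveZ (-2) h4; rewrite (_ : _ *: _ = dominating t) //.
  have sE : Num.sqrt (1 + t) ^+ 2 = 1 + t by rewrite sqr_sqrtr // addr_ge0 // ltW.
  rewrite /dominating; set s := Num.sqrt _ in s0 sE *.
  rewrite -sE /GRing.scale /=; field; exact: lt0r_neq0.
have Fy : F x @[x --> +oo] --> 0.
  rewrite -(mulr0 (-2)); apply: cvgMl_tmp; apply/gtr0_cvgV0.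
    by exists 0; split => // t t0; apply: s_gt0; exact: ltW.
  (* For t > A^2, sqrt(1 + t) >= sqrt(A^2) = |A| >= A. *)
  apply/cvgryPge => A; exists (A ^+ 2); split; first exact: num_real.
  move=> t tA; apply: (@le_trans _ _ `|A|); first exact: ler_norm.
  rewrite -sqrtr_sqr; apply: ler_wsqrtr.
  by apply: (le_trans (ltW tA)); rewrite lerDr.
have int_lt : (\int[mu]_(x in `[0%R, +oo[) (dominating x)%:E < +oo)%E.
  rewrite (ge0_continuous_FTC2y (F := F) (l := 0)) ?ltry //.
  - exact: dominating_ge0.
  - apply: continuous_in_subspaceT => x; rewrite inE /= in_itv /= andbT.
    exact: d_cont.
  - by move=> x x0; have [] := F_der x x0.
  - by apply: cvg_at_right_filter; exact: F_cont.
  - move=> x; rewrite in_itv /= andbT => x0.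
    by rewrite derive1E; have [_] := F_der x x0.
have int_cc : mu.-integrable `[0%R, +oo[ (EFin \o dominating).
  apply/integrableP; split.
    apply/measurable_EFinP.
    apply: subspace_continuous_measurable_fun => //.
    apply: continuous_in_subspaceT => x; rewrite inE /= in_itv /= andbT.
    exact: d_cont.
  apply: le_lt_trans int_lt.
  rewrite le_eqVlt; apply/orP; left; apply/eqP; apply: eq_integral => x.
  rewrite inE /= in_itv /= andbT => x0.
  by rewrite ger0_norm // dominating_ge0.
apply: integrableS int_cc => // x; rewrite /= !in_itv /= !andbT; exact: ltW.
Qed.

(** A pointwise limit of polynomials in t, taken on the half-line where convergence is
    established. *)
Lemma besselI_measurable (D : set R) n : measurable D -> D `<=` [set t | 0 <= t] ->
  measurable_fun D (fun t => besselI (Posz n) t).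
Proof.
move=> mD D0.
apply: (@measurable_fun_cvg _ _ _ _ (fun m t => series (bessel_term (t / 2) n) m)).
  move=> m; rewrite /series /=; apply: measurable_sum => q.
  rewrite /bessel_term; apply: measurable_funM; last exact: measurable_cst.
  apply: measurable_funX; apply: measurable_funM; [exact: measurable_id|exact: measurable_cst].
move=> t /D0 /= t0; rewrite besselI_nat; apply: is_cvg_bessel.
by rewrite divr_ge0.
Qed.

Lemma measurable_inv_pos : measurable_fun (`]0, +oo[ : set R) (fun t : R => t^-1).
Proof.
apply: open_continuous_measurable_fun => //.
move=> x; rewrite inE /= in_itv /= andbT => x0.
by apply: inv_continuous; rewrite gt_eqF.
Qed.

Lemma c_integrand_measurable d : measurable_fun (`]0, +oo[ : set R) (@c_integrand R d).
Proof.
have scale_meas (c : R) : measurable_fun (`]0, +oo[ : set R) (fun t : R => c * t).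
  by apply: measurable_funM; [exact: measurable_cst|exact: measurable_id].
apply: measurable_funM; last exact: measurable_inv_pos.
apply: measurable_funB; last first.
  apply: measurableT_comp => //; exact: measurableT_comp.
apply: measurable_funM.
  apply: measurableT_comp => //; apply: measurableT_comp => //.
apply: measurable_funX.
apply: (@measurable_comp _ _ _ _ _ _ (`]0, +oo[ : set R) (fun t => besselI 0 t)) => //.
  move=> _ [t t0 <-]; move: t0; rewrite /= !in_itv /= !andbT => t0.
  by rewrite mulr_gt0.
apply: besselI_measurable => // t; rewrite /= in_itv /= andbT; exact: ltW.
Qed.

End ConstantIntegrable.

(** * Integrability of the integrand defining c_d *)

Section CIntegrable.
Variable R : realType.
Implicit Types (x t : R).

Let mu := @lebesgue_measure R.

Lemma heat_kernel_bounds t : 0 < t ->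
  expR (- (2 * t)) <= expR (- (2 * t)) * besselI 0 (2 * t) <= 1.
Proof.
move=> t0; have t2 : 0 <= 2 * t by rewrite mulr_ge0 // ltW.
rewrite ler_peMr ?expR_ge0 ?besselI0_ge1 //=.
by rewrite expRN mulrC ler_pdivrMr ?expR_gt0 // mul1r besselI0_le_expR.
Qed.

Lemma heat_kernel_pow d t :
  expR (- (2 * d%:R * t)) * besselI 0 (2 * t) ^+ d =
  (expR (- (2 * t)) * besselI 0 (2 * t)) ^+ d.
Proof. by rewrite exprMn -expRM_natl; congr (expR _ * _); ring. Qed.

Lemma c_integrand_bound d t : (1 <= d)%N -> 0 < t ->
  `|c_integrand d t| <= (6 * d%:R + 2) * dominating R t.
Proof.
move=> d1 t0; rewrite /c_integrand heat_kernel_pow.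
have /andP[r_ge r_le] := heat_kernel_bounds t t0.
set r := _ * besselI 0 _ in r_ge r_le *.
have r0 : 0 <= r by exact: le_trans (expR_ge0 _) r_ge.
have dR : (1 : R) <= d%:R by rewrite ler1n.
have s_gt0 : 0 < Num.sqrt (1 + t) by rewrite sqrtr_gt0 ltr_pwDl // ltW.
have sE : Num.sqrt (1 + t) ^+ 2 = 1 + t by rewrite sqr_sqrtr // addr_ge0 // ltW.
rewrite normrM [`|t^-1|]ger0_norm ?invr_ge0; last exact: ltW.
rewrite ler_pdivrMr // /dominating.
have e1 : 1 - t <= expR (- t) by exact: expR_ge1Dx.
have e2 : expR (- t) <= 1 by rewrite expR_le1 oppr_le0 ltW.
(* For t <= 1 both r^d and e^{-t} lie in [1 - 2dt, 1], so they differ by at most 2dt; the bound (1 +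
   t)^{3/2} <= 3 turns 2d into the 6d of the constant. *)
have [t1|t1] := leP t 1.
  have g1 : r ^+ d <= 1 by exact: exprn_ile1.
  have g2 : 1 - 2 * d%:R * t <= r ^+ d.
    apply: (@le_trans _ _ (expR (- (2 * t)) ^+ d)).
      rewrite -expRM_natl; apply: le_trans (expR_ge1Dx _).
      by rewrite lerD2l mulrN lerN2 le_eqVlt; apply/orP; left; apply/eqP; ring.
    by apply: lerXn2r; rewrite // nnegrE ?expR_ge0.
  apply: (@le_trans _ _ (2 * d%:R * t)).
    have : t <= 2 * d%:R * t by rewrite ler_peMl //; [exact: ltW|lra].
    by move=> h; rewrite ler_norml; apply/andP; split; lra.
  apply: ler_wpM2r; first exact: ltW.
  set s := Num.sqrt _ in s_gt0 sE *.
  rewrite ler_pdivlMr ?mulr_gt0 //; last by lra.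
  have s32 : s <= 3 / 2 by nra.
  have : (1 + t) * s <= 3 by nra.
  have : 0 < (1 + t) * s by rewrite mulr_gt0 //; lra.
  set p := (1 + t) * s; nra.
(* For t > 1 both terms lie in [0, (1 + t)^{-1/2}]. For r this is the bound 1 / (2 sqrt(2t))
   together with 1 + t <= 8t; for e^{-t} it is sqrt(1 + t) <= 1 + t <= e^t. *)
have rs : r <= (Num.sqrt (1 + t))^-1.
  apply: (le_trans (besselI0_le_sqrt _ _ _)); first by rewrite mulr_gt0.
  have s2_gt0 : 0 < Num.sqrt (2 * t) by rewrite sqrtr_gt0 mulr_gt0.
  have s2E : Num.sqrt (2 * t) ^+ 2 = 2 * t by rewrite sqr_sqrtr // mulr_ge0 // ltW.
  rewrite lef_pV2 ?posrE ?mulr_gt0 //.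
  rewrite -(@ler_pXn2r _ 2) ?nnegrE ?mulr_ge0 ?ltW // exprMn sE s2E; lra.
have gs : r ^+ d <= (Num.sqrt (1 + t))^-1.
  by apply: le_trans rs; rewrite -[leRHS]expr1; apply: ler_wiXn2l.
have es : expR (- t) <= (Num.sqrt (1 + t))^-1.
  rewrite expRN lef_pV2 ?posrE ?expR_gt0 //.
  apply: le_trans (expR_ge1Dx t); set s := Num.sqrt _ in s_gt0 sE *.
  by rewrite -subr_ge0; nra.
apply: (@le_trans _ _ (Num.sqrt (1 + t))^-1).
  have := exprn_ge0 d r0; have := expR_ge0 (- t).
  by move=> h1 h2; rewrite ler_norml; apply/andP; split; lra.
set s := Num.sqrt _ in s_gt0 sE *.
have -> : (6 * d%:R + 2) / ((1 + t) * s) * t = s^-1 * ((6 * d%:R + 2) * t / (1 + t)).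
  have t10 : 1 + t != 0 by lra.
  by field; rewrite t10 (lt0r_neq0 s_gt0).
have si0 : 0 <= s^-1 by rewrite invr_ge0 ltW.
apply: ler_peMr => //; rewrite ler_pdivlMr ?mul1r; last by lra.
by nra.
Qed.

Lemma c_integrand_integrable d : (1 <= d)%N ->
  mu.-integrable `]0, +oo[ (EFin \o @c_integrand R d).
Proof.
move=> d1.
have K_int : mu.-integrable `]0, +oo[
    (fun t => (6 * d%:R + 2)%:E * (dominating R t)%:E)%E.
  by apply: integrableZl => //; exact: integrable_dominating.
apply: le_integrable K_int => //.
  by apply/measurable_EFinP; exact: c_integrand_measurable.
move=> t; rewrite /= in_itv /= andbT => t0.
rewrite lee_fin [leRHS]ger0_norm; first exact: c_integrand_bound.
by rewrite mulr_ge0 ?dominating_ge0 ?ltW // addr_ge0 // mulr_ge0.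
Qed.

End CIntegrable.

(** * Frullani's integral *)

Section Frullani.
Variable R : realType.
Implicit Types (p q s t : R).

Let mu := @lebesgue_measure R.

Lemma integral_expR_scale s : 0 < s ->
  (\int[mu]_(t in `]0%R, +oo[) (expR (- (s * t)))%:E = (s^-1)%:E)%E.
Proof.
move=> s0.
have e_cont : continuous (fun t : R => expR (- (s * t))).
  move=> t; apply: continuous_comp; last exact: continuous_expR.
  by apply: cvgN; apply: cvgMl_tmp; exact: cvg_id.
rewrite integral_itv_obnd_cbnd; last first.
  apply/measurable_EFinP; apply: measurable_funTS.
  exact: continuous_measurable_fun.
pose F t : R := - s^-1 * expR (- (s * t)).
have F_der t : is_derive t 1 F (expR (- (s * t))).
  have h1 : is_derive t 1 (fun t : R => - s * t) (- s).
    by have := is_deriveZ (- s) (is_derive_id t 1); rewrite /GRing.scale /= mulr1.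
  have h2 := is_derive1_comp (is_derive_expR (- s * t)) h1.
  have := is_deriveZ (- s^-1) h2.
  rewrite (_ : _ *: _ = expR (- (s * t))); last first.
    by rewrite /GRing.scale /= [- s * t]mulNr; field; rewrite gt_eqF.
  rewrite (_ : _ \*: _ = F) //; apply/funext => x.
  by rewrite /F /GRing.scale /= [- s * x]mulNr.
rewrite (ge0_continuous_FTC2y (F := F) (l := 0)).
- by rewrite /F mulr0 oppr0 expR0 mulr1 -EFinB sub0r opprK.
- by move=> t _; exact: expR_ge0.
- exact: continuous_subspaceT.
- rewrite -(mulr0 (- s^-1)); apply: cvgMl_tmp.
  apply: (cvg_comp (fun t => s * t) (fun t => expR (- t))); last exact: cvgr_expR.
  by apply: gt0_cvgMry => //; exact: cvg_id.
- by move=> t _; have [] := F_der t.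
- apply: cvg_at_right_filter; apply: cvgMl_tmp; exact: e_cont.
- by move=> t _; rewrite derive1E; have [_] := F_der t.
Qed.

Lemma integral_inv p q : 0 < p -> p < q ->
  (\int[mu]_(s in `[p, q]) (s^-1)%:E = (ln q - ln p)%:E)%E.
Proof.
move=> p0 pq; rewrite (continuous_FTC2 (F := @ln R)) ?EFinB //.
- apply: continuous_in_subspaceT => x; rewrite inE /= in_itv /= => /andP[px _].
  by apply: inv_continuous; rewrite gt_eqF // (lt_le_trans p0).
- split.
  + move=> x; rewrite in_itv /= => /andP[px _].
    by have [] := is_derive1_ln (lt_trans p0 px).
  + by apply: cvg_at_right_filter; exact: continuous_ln.
  + by apply: cvg_at_left_filter; apply: continuous_ln; exact: lt_trans pq.
- move=> x; rewrite in_itv /= => /andP[px _].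
  by rewrite derive1E; have [_] := is_derive1_ln (lt_trans p0 px).
Qed.

Lemma integral_expR_param p q t : p < q -> 0 < t ->
  (\int[mu]_(s in `[p, q]) (expR (- (s * t)))%:E =
   ((expR (- (p * t)) - expR (- (q * t))) / t)%:E)%E.
Proof.
move=> pq t0.
pose F s : R := - t^-1 * expR (- (s * t)).
have e_cont : continuous (fun s : R => expR (- (s * t))).
  move=> s; apply: continuous_comp; last exact: continuous_expR.
  by apply: cvgN; apply: cvgMr_tmp; exact: cvg_id.
have F_der s : is_derive s 1 F (expR (- (s * t))).
  have h1 : is_derive s 1 (fun s : R => - t * s) (- t).
    by have := is_deriveZ (- t) (is_derive_id s 1); rewrite /GRing.scale /= mulr1.
  have h2 := is_derive1_comp (is_derive_expR (- t * s)) h1.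
  have := is_deriveZ (- t^-1) h2.
  rewrite (_ : _ *: _ = expR (- (s * t))); last first.
    by rewrite /GRing.scale /= [- t * s]mulNr [t * s]mulrC; field; rewrite gt_eqF.
  rewrite (_ : _ \*: _ = F) //; apply/funext => x.
  by rewrite /F /GRing.scale /= [- t * x]mulNr [t * x]mulrC.
rewrite (continuous_FTC2 (F := F)) //.
- by rewrite -EFinB /F; congr EFin; ring.
- exact: continuous_subspaceT.
- split.
  + by move=> x _; have [] := F_der x.
  + by apply: cvg_at_right_filter; apply: cvgMl_tmp; exact: e_cont.
  + by apply: cvg_at_left_filter; apply: cvgMl_tmp; exact: e_cont.
- by move=> x _; rewrite derive1E; have [_] := F_der x.
Qed.

(* Tonelli applied to [expR (- (s * t))] on [p, q] x ]0, +oo[. *)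
Lemma frullani_lt p q : 0 < p -> p < q ->
  (\int[mu]_(t in `]0%R, +oo[)
     ((expR (- (p * t)) - expR (- (q * t))) / t)%:E = (ln q - ln p)%:E)%E.
Proof.
move=> p0 pq.
(* The two intervals are encoded by indicators because Tonelli is applied on the whole plane. *)
pose f (z : R * R) : \bar R :=
  (expR (- (z.1 * z.2)) * \1_(`[p, q]%classic : set R) z.1 *
   \1_(`]0, +oo[%classic : set R) z.2)%:E.
have f_meas : measurable_fun setT f.
  apply/measurable_EFinP; apply: measurable_funM; last first.
    by apply: measurableT_comp => //; exact: measurable_indic.
  apply: measurable_funM; last first.
    by apply: measurableT_comp => //; exact: measurable_indic.
  do 2 apply: measurableT_comp => //.
  by apply: measurable_funM.
have f_ge0 z : (0 <= f z)%E.
  by rewrite lee_fin !mulr_ge0 ?expR_ge0 // indicE.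
have := fubini_tonelli (m1 := mu) (m2 := mu) f f_meas f_ge0.
(* Integrating in t first gives 1/s on [p, q], hence the logarithms; the other order gives the
   Frullani integrand. *)
have -> : (\int[mu]_s \int[mu]_t f (s, t) = (ln q - ln p)%:E)%E.
  rewrite -(integral_inv _ _ p0 pq) [RHS]integral_mkcond epatch_indic.
  apply: eq_integral => s _ /=.
  have [spq|spq] := boolP (s \in (`[p, q]%classic : set R)); last first.
    rewrite integral0_eq ?indicE ?(negbTE spq) ?mule0 // => t _.
    by rewrite /f /= indicE (negbTE spq) mulr0 mul0r.
  have s0 : 0 < s by move: spq; rewrite inE /= in_itv /= => /andP[/(lt_le_trans p0)].
  rewrite [in RHS]indicE spq mule1 -integral_expR_scale // [RHS]integral_mkcond.
  rewrite epatch_indic; apply: eq_integral => t _ /=.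
  by rewrite /f /= [X in _ * X * _]indicE spq mulr1 EFinM.
move=> ->; rewrite [LHS]integral_mkcond epatch_indic.
apply: eq_integral => t _ /=.
have [t0|t0] := boolP (t \in (`]0, +oo[%classic : set R)); last first.
  rewrite integral0_eq ?indicE ?(negbTE t0) ?mule0 // => s _.
  by rewrite /f /= [X in _ * _ * X]indicE (negbTE t0) mulr0.
have tgt0 : 0 < t by move: t0; rewrite inE /= in_itv /= andbT.
rewrite [in LHS]indicE t0 mule1 -integral_expR_param // [LHS]integral_mkcond.
rewrite epatch_indic; apply: eq_integral => s _ /=.
by rewrite /f /= [X in _ * _ * X]indicE t0 mulr1 EFinM.
Qed.

End Frullani.

Section FrullaniIntegrable.
Variable R : realType.
Implicit Types (p q t : R).

Let mu := @lebesgue_measure R.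

Let frullani_integrand p q t : R := (expR (- (p * t)) - expR (- (q * t))) / t.

Lemma frullani_measurable p q :
  measurable_fun (`]0, +oo[ : set R) (frullani_integrand p q).
Proof.
have e_meas c : measurable_fun (`]0, +oo[ : set R) (fun t : R => expR (- (c * t))).
  have c_meas : measurable_fun (`]0, +oo[ : set R) (fun t : R => c * t).
    by apply: measurable_funM; [exact: measurable_cst|exact: measurable_id].
  by apply: measurableT_comp => //; exact: measurableT_comp.
apply: measurable_funM; last exact: measurable_inv_pos.
exact: measurable_funB.
Qed.

(** For p < q the integrand is positive, so the integral of its absolute value is the finite one
    already computed. *)
Lemma frullani_integrable_lt p q : 0 < p -> p < q ->
  mu.-integrable `]0, +oo[ (EFin \o frullani_integrand p q).
Proof.
move=> p0 pq; apply/integrableP; split.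
  by apply/measurable_EFinP; exact: frullani_measurable.
apply: (@le_lt_trans _ _ (\int[mu]_(t in `]0%R, +oo[)
    (frullani_integrand p q t)%:E)%E); last by rewrite frullani_lt ?ltry.
rewrite le_eqVlt; apply/orP; left; apply/eqP; apply: eq_integral => t.
rewrite inE /= in_itv /= andbT => t0.
rewrite ger0_norm // divr_ge0 ?ltW // subr_gt0 ltr_expR ltrN2.
by rewrite ltr_pM2r.
Qed.

Lemma frullani p q : 0 < p -> 0 < q ->
  mu.-integrable `]0, +oo[ (EFin \o frullani_integrand p q) /\
  (\int[mu]_(t in `]0, +oo[) frullani_integrand p q t)%R = ln q - ln p.
Proof.
wlog pq : p q / p <= q => [hw p0 q0|p0 q0].
  have [pq|/ltW qp] := leP p q; first exact: hw.
  have [i1 i2] := hw q p qp q0 p0.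
  have -> : frullani_integrand p q = fun t => -1 * frullani_integrand q p t.
    by apply/funext => t; rewrite /frullani_integrand; ring.
  split; first exact: (integrableZl _ _ i1).
  by rewrite RintegralZl // i2; ring.
move: pq; rewrite le_eqVlt => /predU1P[->|pq].
  (* For p = q the integrand is zero, written as a zero multiple of an integrable one. *)
  have -> : frullani_integrand q q = fun t => 0 * frullani_integrand q (q + 1) t.
    by apply/funext => t; rewrite /frullani_integrand subrr !mul0r.
  have i1 : mu.-integrable `]0, +oo[ (EFin \o frullani_integrand q (q + 1)).
    by apply: frullani_integrable_lt => //; rewrite ltrDl.
  split; first exact: (integrableZl _ _ i1).
  by rewrite RintegralZl // mul0r subrr.
split; first exact: frullani_integrable_lt.
by rewrite /Rintegral frullani_lt.
Qed.

End FrullaniIntegrable.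

(** * Spectrum of the bundle Laplacian *)

(** Distributivity for index sets that vary with i, needed because the cyclic factors have different
    lengths. Dependent families become functions into a tagged sum, where the non-dependent law
    applies. *)
Lemma bigA_distr_dffun (K : comPzRingType) (I : finType) (T : I -> finType)
    (F : forall i, T i -> K) :
  \prod_i \sum_(x : T i) F i x =
  \sum_(v : {dffun forall i, T i}) \prod_i F i (v i).
Proof.
rewrite (reindex (@dffun_of_fprod I T)); last exact/onW_bij/dffun_of_fprod_bij.
transitivity (\sum_(t : fprod T) \prod_(i in I) (finfun (F i)) (t i)); last first.
  by apply: eq_bigr => t _; apply: eq_bigr => i _; rewrite !ffunE.
rewrite big_fprod.
under eq_bigr => i _ do rewrite (big_tag F i).
rewrite bigA_distr_big_dep; apply: eq_bigr => g /familyP gP.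
apply: eq_bigr => i _.
by case: (g i) => j x; rewrite /untag; case: eqP => // e; rewrite ffunE.
Qed.

Section Spectrum.
Variables (R : realType) (d : nat) (a : 'I_d -> nat).
Variable w : forall i : 'I_d, 'I_(a i) -> R[i].
Arguments w : clear implicits.
Variable lam : 'I_d -> R.
Hypothesis a_gt0 : forall i, (0 < a i)%N.
Hypothesis w_neq0 : forall i j, w i j != 0.
Hypothesis w_prod : forall i, \prod_(j < a i) w i j = expi (2 * pi * lam i).

Definition angle (i : 'I_d) (m : nat) : R := 2 * pi * (m%:R + lam i) / (a i)%:R.

(** The product over j < x is parallel transport from 0 to x along the i-th cycle. *)
Definition eigenchar (i : 'I_d) (m : nat) (x : 'I_(a i)) : R[i] :=
  expi (- angle i m) ^+ x * \prod_(j < a i | (j < x)%N) w i j.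

Lemma eigenchar_neq0 i m x : eigenchar i m x != 0.
Proof.
rewrite mulf_neq0 ?expf_neq0 ?expi_neq0 //.
by apply/prodf_neq0 => j _; exact: w_neq0.
Qed.

(** Dividing by w_x undoes the transport along one edge, so the twisted shift acts by the scalar z =
    [expi (- angle i m)]. *)
Lemma eigenchar_ordS i m x :
  (w i x)^-1 * eigenchar i m (ordS x) = expi (- angle i m) * eigenchar i m x.
Proof.
apply: (mulfI (w_neq0 i x)); rewrite mulrA mulfV // mul1r /eigenchar /=.
have prodS : w i x * \prod_(j < a i | (j < x)%N) w i j =
    \prod_(j < a i | (j < x.+1)%N) w i j.
  rewrite [RHS](bigD1 x) //=; congr (_ * _); apply: eq_bigl => j.
  by rewrite ltnS ltn_neqAle andbC -val_eqE.
rewrite [RHS]mulrCA [X in _ = _ * X]mulrCA prodS mulrA -exprS.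
(* At x = a - 1 the successor wraps to 0, and z^a times the holonomy is e^{-2 pi i m} = 1. *)
have := ltn_ord x; rewrite leq_eqVlt => /predU1P[xE|xa]; last by rewrite modn_small.
rewrite xE modnn expr0 mul1r big_pred0 //.
have aR : ((a i)%:R : R) != 0 by rewrite pnatr_eq0 -lt0n.
have -> : \prod_(j < a i | (j < a i)%N) w i j = \prod_(j < a i) w i j.
  by apply: eq_bigl => j; rewrite ltn_ord.
rewrite w_prod expiX -expiD.
have -> : (a i)%:R * - angle i m + 2 * pi * lam i = - (2 * pi * m%:R).
  by rewrite /angle; field.
by rewrite expiN expi2piz invr1.
Qed.

Definition eigenvec (k v : vertex a) : R[i] := \prod_i eigenchar i (k i) (v i).

Definition eigenval (k : vertex a) : R := \sum_i (2 - 2 * cos (angle i (k i))).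

Lemma eigenvec_move k v s : eigenvec k (move v s) =
  eigenvec k v / eigenchar s.1 (k s.1) (v s.1)
  * eigenchar s.1 (k s.1) (if s.2 then ordS (v s.1) else ord_pred (v s.1)).
Proof.
rewrite /eigenvec (bigD1 s.1) //= [X in _ = X / _ * _](bigD1 s.1) //=.
rewrite ffunE eqxx [_ / _]mulrAC mulfV ?eigenchar_neq0 // mul1r mulrC.
by congr (_ * _); apply: eq_bigr => i /negbTE is1; rewrite ffunE is1.
Qed.

(** In direction i the neighbour v + e_i contributes z and v - e_i contributes z^{-1}, which leaves
    2 - z - z^{-1} = 2 - 2 cos. *)
Lemma laplacian_eigenvec k v :
  laplacian w (eigenvec k) v = (eigenval k)%:C * eigenvec k v.
Proof.
rewrite /laplacian.
rewrite -(pair_big xpredT xpredT (fun i b => eigenvec k v - edge_weight w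
  (move v (i, b)) (opposite (i, b)) * eigenvec k (move v (i, b)))) /=.
rewrite /eigenval rmorph_sum mulr_suml; apply: eq_bigr => i _.
rewrite big_bool /= !eigenvec_move /=.
set e := eigenchar i (k i).
set z := expi (- angle i (k i)).
have z0 : z != 0 by exact: expi_neq0.
have e0 x : e x != 0 by exact: eigenchar_neq0.
have -> : edge_weight w (move v (i, true)) (opposite (i, true)) = (w i (v i))^-1.
  by rewrite /edge_weight /opposite /= !ffunE !eqxx /= ordSK.
have -> : edge_weight w (move v (i, false)) (opposite (i, false)) =
    w i (ord_pred (v i)).
  by rewrite /edge_weight /opposite /= !ffunE eqxx.
have eS : (w i (v i))^-1 * e (ordS (v i)) = z * e (v i) := eigenchar_ordS _ _ _.
have eP : e (v i) = z * e (ord_pred (v i)) * w i (ord_pred (v i)).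
  rewrite -(eigenchar_ordS i (k i) (ord_pred (v i))) ord_predK -/e.
  by rewrite mulrAC mulVf // mul1r.
have h1 : (w i (v i))^-1 * (eigenvec k v / e (v i) * e (ordS (v i))) =
    z * eigenvec k v.
  rewrite mulrCA eS; field; exact: e0.
have h2 : w i (ord_pred (v i)) * (eigenvec k v / e (v i) * e (ord_pred (v i))) =
    z^-1 * eigenvec k v.
  by rewrite eP; field; rewrite z0 e0 w_neq0.
rewrite h1 h2.
have -> : (2 - 2 * cos (angle i (k i)))%:C = 2 - z - z^-1.
  rewrite /z -expiN opprK; apply/eqP.
  rewrite eq_complex /= cosN sinN; apply/andP; split; apply/eqP; ring.
by ring.
Qed.

Lemma sum_delta_vertex (v : vertex a) (g : vertex a -> R[i]) :
  \sum_(r < #|vertex a|) (v == enum_val r)%:R * g (enum_val r) = g v.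
Proof.
rewrite (bigD1 (enum_rank v)) //= enum_rankK eqxx mul1r big1 ?addr0 // => r rv.
case: eqP => [vr|_]; last by rewrite mul0r.
by move: rv; rewrite vr enum_valK eqxx.
Qed.

(** The transport factors cancel in the quotient, leaving a geometric sum of e^{2 pi i (m - m') /
    a}. The inverse takes the place of complex conjugation. *)
Lemma eigenchar_orthogonal i (m m' : 'I_(a i)) :
  \sum_x (eigenchar i m x)^-1 * eigenchar i m' x =
  if m == m' then (a i)%:R else 0.
Proof.
have aR : ((a i)%:R : R) != 0 by rewrite pnatr_eq0 -lt0n.
pose u := expi (2 * pi * ((m%:R - m'%:R) / (a i)%:R) : R).
have uE (x : 'I_(a i)) : (eigenchar i m x)^-1 * eigenchar i m' x = u ^+ x.
  have p0 : \prod_(j < a i | (j < x)%N) w i j != 0.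
    by apply/prodf_neq0 => j _; exact: w_neq0.
  rewrite /eigenchar invfM mulrACA mulVf // mulr1 -exprVn -exprMn -expiN -expiD.
  by congr (expi _ ^+ _); rewrite /angle; field.
under eq_bigr do rewrite uE.
case: eqP => [mm|/eqP mm].
  rewrite /u mm subrr mul0r mulr0 expi0.
  by under eq_bigr do rewrite expr1n; rewrite sumr_const card_ord.
apply: sum_expr_root1.
  rewrite expiX (_ : _ * _ = 2 * pi * m%:R + - (2 * pi * m'%:R)); last by field.
  by rewrite expiD expiN !expi2piz invr1 mulr1.
apply: expi_eq1_frac; rewrite normrM normrV ?unitfE // [`|(a i)%:R|]ger0_norm //.
rewrite divr_gt0 ?ltr0n // ?normr_gt0 ?subr_eq0 ?eqr_nat //=.
rewrite ltr_pdivrMr ?ltr0n // mul1r ltr_norml.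
have := ltn_ord m; have := ltn_ord m'.
rewrite -!(ltr_nat R) => h1 h2.
have h3 : (0 : R) <= m%:R by []. have h4 : (0 : R) <= m'%:R by [].
by apply/andP; split; lra.
Qed.

Lemma eigenvec_orthogonal k k' :
  \sum_v (eigenvec k v)^-1 * eigenvec k' v =
  if k == k' then (volume a)%:R else 0.
Proof.
under eq_bigr do rewrite /eigenvec -prodfV -big_split.
rewrite -(bigA_distr_dffun _ _ _ (fun i x =>
  (eigenchar i (k i) x)^-1 * eigenchar i (k' i) x)) /=.
under eq_bigr do rewrite eigenchar_orthogonal.
case: eqP => [->|/eqP kk].
  by rewrite /volume natr_prod; apply: eq_bigr => i _; rewrite eqxx.
have [i ki] : exists i, k i != k' i.
  apply/existsP; apply: contraR kk => /existsPn kk.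
  by apply/eqP/ffunP => i; apply/eqP; have := kk i; rewrite negbK.
by rewrite (bigD1 i) //= (negbTE ki) mul0r.
Qed.

Lemma volume_gt0 : (0 < volume a)%N.
Proof. by rewrite prodn_gt0. Qed.

(** The columns of [P] are the eigenvectors. Orthogonality makes [Q] a scalar multiple of its
    inverse, so det P can be cancelled from the determinants of L P = P D. *)
Lemma det_laplacian :
  \det (laplacian_mx w) = (\prod_(k : vertex a) eigenval k)%:C.
Proof.
pose P : 'M[R[i]]_#|vertex a| := \matrix_(p, q) eigenvec (enum_val q) (enum_val p).
pose Q : 'M[R[i]]_#|vertex a| := \matrix_(p, q) (eigenvec (enum_val p) (enum_val q))^-1.
pose D : 'rV[R[i]]_#|vertex a| := \row_q (eigenval (enum_val q))%:C.
have QP : Q *m P = (volume a)%:R%:M.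
  apply/matrixP => p q; rewrite !mxE.
  under eq_bigr do rewrite !mxE.
  have := eigenvec_orthogonal (enum_val p) (enum_val q).
  rewrite (reindex (@enum_val (vertex a) predT)); last exact/onW_bij/enum_val_bij.
  by rewrite /= => ->; rewrite (inj_eq enum_val_inj); case: eqP.
have detP : \det P != 0.
  apply/eqP => P0; have := congr1 determinant QP.
  rewrite det_mulmx P0 mulr0 det_scalar => /esym/eqP.
  by rewrite expf_eq0 pnatr_eq0 eqn0Ngt volume_gt0 andbF.
have LP : laplacian_mx w *m P = P *m diag_mx D.
  apply/matrixP => p q; rewrite mul_mx_diag !mxE mulrC -laplacian_eigenvec.
  under eq_bigr do rewrite !mxE.
  rewrite /laplacian; under eq_bigr do rewrite mulr_suml.
  rewrite exchange_big /=; apply: eq_bigr => s _.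
  under eq_bigr do rewrite mulrBl -mulrA.
  by rewrite sumrB -mulr_sumr !sum_delta_vertex.
have := congr1 determinant LP; rewrite !det_mulmx det_diag mulrC => /(mulfI detP) ->.
rewrite rmorph_prod /= [RHS](reindex (@enum_val (vertex a) predT)) /=.
  by apply: eq_bigr => r _; rewrite mxE.
exact/onW_bij/enum_val_bij.
Qed.

(** In each coordinate the factor e^{-2t} turns e^{2t cos} into e^{-t(2 - 2 cos)}; distributing the
    product over coordinates then adds up the exponents. *)
Lemma theta_trace t : (0 <= t) ->
  theta w t = (\sum_(k : vertex a) expR (- (t * eigenval k)))%:C.
Proof.
move=> t0; have t2 : 0 <= 2 * t by rewrite mulr_ge0.
transitivity (\prod_i \sum_(m < a i) expR (- (t * (2 - 2 * cos (angle i m)))))%:C.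
  rewrite /theta rmorph_prod; apply: eq_bigr => i _.
  rewrite mulrAC (csumZ_bessel _ _ _ (lam i)) // -rmorphM /= mulr_suml; congr (_%:C).
  apply: eq_bigr => m _; rewrite -expRD; congr expR; rewrite /angle; ring.
congr (_%:C).
rewrite (bigA_distr_dffun _ _ _ (fun i (m : 'I_(a i)) =>
  expR (- (t * (2 - 2 * cos (angle i m)))))).
apply: eq_bigr => k _; rewrite -expR_sum; congr expR.
by rewrite /eigenval mulr_sumr -sumrN.
Qed.

Lemma angle_cos_le1 i m : 0 <= 2 - 2 * cos (angle i m).
Proof. by have := cos_le1 (angle i m); lra. Qed.

(** The i-th summand is 4 sin(pi q)^2 with q = (k_i + lambda_i) / a_i strictly between 0 and 1; the
    other summands are nonnegative. *)
Lemma eigenval_gt0 (k : vertex a) :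
  (exists i, 0 < lam i < 1) -> 0 < eigenval k.
Proof.
move=> [i /andP[l0 l1]]; rewrite /eigenval (bigD1 i) //=.
rewrite ltr_pwDl //; last by rewrite sumr_ge0 // => j _; exact: angle_cos_le1.
set q := ((k i)%:R + lam i) / (a i)%:R.
have aR : (0 : R) < (a i)%:R by rewrite ltr0n.
have k0 : (0 : R) <= (k i)%:R by [].
have ka : ((k i)%:R : R) + 1 <= (a i)%:R by rewrite natr1 ler_nat.
have q0 : 0 < q by rewrite divr_gt0 //; lra.
have q1 : q < 1 by rewrite ltr_pdivrMr // mul1r; lra.
have -> : angle i (k i) = (pi * q) *+ 2 by rewrite /angle /q; ring.
rewrite cos_mulr2n cos2sin2 -mulr_natl.
have s0 : 0 < sin (pi * q).
  by apply: sin_gt0_pi; rewrite mulr_gt0 ?pi_gt0 //= gtr_pMr ?pi_gt0.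
have : 0 < sin (pi * q) ^+ 2 by rewrite exprn_gt0.
lra.
Qed.

End Spectrum.

(** * Assembly of the determinant formula *)

Lemma card_vertex d (a : 'I_d -> nat) : #|vertex a| = volume a.
Proof.
have := bigA_distr_dffun int _ _ (fun (i : 'I_d) (_ : 'I_(a i)) => 1).
under eq_bigr do rewrite sumr_const card_ord.
under [RHS]eq_bigr do rewrite big1 //.
by rewrite -natr_prod sumr_const => /eqP; rewrite eqr_nat => /eqP.
Qed.

Lemma integral_sum_fun (R : realType) (D : set R) (I : Type) (s : seq I)
    (f : I -> R -> R) : measurable D ->
  (forall i, (@lebesgue_measure R).-integrable D (EFin \o f i)) ->
  (@lebesgue_measure R).-integrable D (EFin \o (fun t => \sum_(i <- s) f i t)) /\
  (\int[lebesgue_measure]_(t in D) \sum_(i <- s) f i t)%R =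
  \sum_(i <- s) (\int[lebesgue_measure]_(t in D) f i t)%R.
Proof.
move=> mD fi; elim: s => [|i s [IH1 IH2]].
  have -> : (fun t => \sum_(i <- [::]) f i t) = cst (0 : R).
    by apply/funext => t; rewrite big_nil.
  rewrite big_nil; split; first exact: integrable0.
  by rewrite Rintegral_cst // mul0r.
have -> : (fun t => \sum_(j <- i :: s) f j t) =
    (fun t => f i t + \sum_(j <- s) f j t).
  by apply/funext => t; rewrite big_cons.
rewrite big_cons; split; first exact: integrableD (fi i) IH1.
by rewrite RintegralD // IH2.
Qed.

Lemma ln_prod (R : realType) (I : finType) (f : I -> R) :
  (forall i, 0 < f i) -> ln (\prod_i f i) = \sum_i ln (f i).
Proof.
move=> f0; apply: expR_inj; rewrite lnK; last by rewrite posrE prodr_gt0.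
by rewrite expR_sum; apply: eq_bigr => i _; rewrite lnK ?posrE.
Qed.

Lemma clog_pos (R : realType) (x : R) : 0 < x -> clog x%:C = (ln x)%:C.
Proof.
move=> x0; rewrite /clog /carg /= lexx expr0n addr0 sqrtr_sqr gtr0_norm //.
by rewrite divff ?gt_eqF // acos1.
Qed.

Theorem theorem4p1 (R : realType) (d : nat) (hd : (1 <= d)%N)
    (a : nat -> 'I_d -> nat) (alpha : 'I_d -> R)
    (ha : forall n i, (0 < a n i)%N)
    (halpha : forall i, 0 < alpha i)
    (ha_lim : forall i, (a n i)%:R / n%:R @[n --> \oo] --> alpha i)
    (w : forall (n : nat) (i : 'I_d), 'I_(a n i) -> R[i])
    (hw : forall n i (j : 'I_(a n i)), `|w n i j| = 1)
    (lam : nat -> 'I_d -> R) (lam_oo : 'I_d -> R)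
    (hlam : forall n i, 0 <= lam n i < 1)
    (hlam_prod : forall n i,
       \prod_(j < a n i) w n i j = expi (2 * pi * lam n i))
    (hlam_oo : forall i, 0 <= lam_oo i <= 1)
    (hlam_lim : forall i, lam n i @[n --> \oo] --> lam_oo i)
    (hnontriv : exists i : 'I_d,
       [/\ lam_oo i != 0, lam_oo i != 1 & forall n, lam n i != 0])
    (n : nat) :
  [/\ (@lebesgue_measure R).-integrable `]0, +oo[ (EFin \o @c_integrand R d),
      cintegrable `]0, +oo[ (H_integrand (w n)) &
      clog (\det (laplacian_mx (w n)))
        = (volume (a n))%:R * (c_const R d)%:C + H_const (w n)].
Proof.
have w_neq0 i j : w n i j != 0 by rewrite -normr_gt0 hw.
pose ev : vertex (a n) -> R := eigenval R d (a n) (lam n).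
have ev_gt0 k : 0 < ev k.
  apply: eigenval_gt0 => //; have [i [_ _ li]] := hnontriv.
  by exists i; have /andP[l0 ->] := hlam n i; rewrite lt0r li l0.
have c_int := c_integrand_integrable R d hd.
pose V : R := (volume (a n))%:R.
(* Frullani against exponent 1 gives -ln([ev k]) and uses the same e^{-t} that [c_integrand]
   subtracts. *)
pose fr k (t : R) : R := (expR (- (ev k * t)) - expR (- (1 * t))) / t.
pose h (t : R) : R := \sum_k fr k t - V * c_integrand d t.
have HE t : 0 < t -> H_integrand (w n) t = (h t)%:C.
  move=> t0; rewrite /H_integrand.
  rewrite (theta_trace R d (a n) (w n) (lam n)) ?(ltW t0) // complex_natr.
  rewrite -rmorphM -rmorphB -fmorph_div; congr (_%:C).
  (* There are V eigenvalues, so the two contributions V e^{-t} cancel. *)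
  rewrite /h /fr /c_integrand -mulr_suml sumrB sumr_const card_vertex -/V.
  under [in RHS]eq_bigr do rewrite mulrC.
  by rewrite mul1r -[_ *+ _]mulr_natl -/V; ring.
have frE k := frullani R (ev k) 1 (ev_gt0 k) ltr01.
have [fr_int fr_eq] := integral_sum_fun R `]0, +oo[%classic _ (index_enum _) fr
  (measurable_itv _) (fun k => (frE k).1).
have Vc_int : (@lebesgue_measure R).-integrable `]0, +oo[
    (EFin \o (fun t => V * c_integrand d t)).
  exact: (integrableZl _ V c_int).
have h_int : (@lebesgue_measure R).-integrable `]0, +oo[ (EFin \o h).
  exact: (integrableB _ fr_int Vc_int).
have h_eq : (\int[lebesgue_measure]_(t in `]0, +oo[) h t)%R =
    - \sum_k ln (ev k) + V * c_const R d.
  rewrite RintegralB // fr_eq RintegralZl // /c_const mulrN.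
  congr (_ - _); rewrite -sumrN; apply: eq_bigr => k _.
  by rewrite (frE k).2 ln1 sub0r.
have in_pos (t : R) : t \in (`]0, +oo[%classic : set R) -> 0 < t.
  by rewrite inE /= in_itv /= andbT.
split => //.
- split.
    apply: eq_integrable h_int => // t /in_pos t0 /=.
    by rewrite HE.
  apply: (@eq_integrable _ _ _ _ _ _ (cst 0%E)) => //; last exact: integrable0.
  by move=> t /in_pos t0 /=; rewrite HE.
rewrite (det_laplacian R d (a n) (w n) (lam n)) //.
(* Positive eigenvalues put the determinant on the positive real axis, where the principal logarithm
   is [ln]. *)
rewrite clog_pos ?prodr_gt0 // ln_prod // /H_const /cintegral.
have re_eq : (\int[lebesgue_measure]_(t in `]0, +oo[)
    complex.Re (H_integrand (w n) t))%R = - \sum_k ln (ev k) + V * c_const R d.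
  by rewrite -h_eq; apply: eq_Rintegral => t /in_pos t0; rewrite HE.
have im_eq : (\int[lebesgue_measure]_(t in `]0, +oo[)
    complex.Im (H_integrand (w n) t))%R = 0.
  (* The half-line has infinite measure, to which [fine] assigns a default real value; the factor 0
     makes that value harmless. *)
  rewrite -[RHS](mul0r (fine (lebesgue_measure (`]0, +oo[%classic : set R)))).
  by rewrite -Rintegral_cst //; apply: eq_Rintegral => t /in_pos t0; rewrite HE.
rewrite re_eq im_eq complex_natr -/V.
apply/eqP; rewrite eq_complex /=; apply/andP; split; apply/eqP; ring.
Qed.
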